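(* Let $\gamma(s)=(r(s),\theta(s))$ be an $h$-unit speed geodesic of $(M,h)$ with Clairaut constant $\nu$, making an angle $\phi(s)$ with the profile curve (meridian) passing through $\gamma(s)$, and let $\mathcal P(s)=(r(s),\theta(s)+\mu s)$ be the corresponding $F$-geodesic on the rotational Randers surface of revolution $(M,F)$. Let $\psi(s)$ be the angle between $\dot{\mathcal P}(s)$ and the profile curve passing through $\mathcal P(s)$. Then, with $m=m(r(s))$, $$\sqrt{1+2\mu\nu+\mu^2m^2}\,\cos(\psi-\phi)=1+\mu\nu$$ and $$m\sin\psi=\frac{\nu+\mu m^2}{\sqrt{1+2\mu\nu+\mu^2m^2}}.$$
   Context: A Riemannian surface of revolution $(M,h)$ with vertex $p$ is a complete Riemannian manifold homeomorphic to $\mathbb R^2$ whose metric, in $h$-geodesic polar coordinates $(r,\theta)\in[0,\infty)\times(0,2\pi]$ around $p$, is $h=dr^2+m^2(r)\,d\theta^2$, where $m:[0,\infty)\to[0,\infty)$ is a smooth odd function with $m(0)=0$, $m'(0)=1$ (and $m(r)>0$ for $r>0$). Let $\mu>0$ be a constant with $m(r)<\frac1\mu$ for all $r\ge0$, and let $W=\mu\frac{\partial}{\partial\theta}$. The rotational Randers metric with navigation data $(h,W)$ is $F(x,y)=\frac{\sqrt{\lambda\,h(y,y)+h(W,y)^2}}{\lambda}-\frac{h(W,y)}{\lambda}$, $\lambda=1-\mu^2m^2(r)$. Its unit speed geodesics are the curves $\mathcal P(s)=(r(s),\theta(s)+\mu s)$, where $\gamma(s)=(r(s),\theta(s))$ is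 an $h$-unit speed geodesic; $\mathcal P$ is called the $F$-geodesic corresponding to $\gamma$. The profile curves (meridians) are the curves $\theta=$ const. The Clairaut constant of an $h$-unit speed geodesic $\gamma(s)=(r(s),\theta(s))$ is the constant $\nu=m^2(r(s))\frac{d\theta}{ds}$; it satisfies $m(r(s))\sin\phi(s)=\nu$. Angles $\phi,\psi$ are measured with respect to $h$, oriented from $\frac{\partial}{\partial r}$ towards $\frac{\partial}{\partial\theta}$, at points different from the vertex. *)

(* Defs.v *)
From Stdlib Require Import Reals Lra Psatz.
From Coquelicot Require Import Coquelicot.
Open Scope R_scope.

(* Off the vertex p, points are written (r, theta) in h-geodesic polar
   coordinates around p, with theta a real number (a lift of the angle), and
   tangent vectors by their components along d/dr and d/dtheta. *)
Definition point : Type := (R * R)%type.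
Definition tangent : Type := (R * R)%type.

(* The profile function m is the odd extension to R of m : [0,oo) -> [0,oo);
   "smooth odd function" is smoothness of that extension, including at 0.
   With m defined on all of [0,oo), dr^2 + m^2 dtheta^2 extends to a complete
   metric on R^2. *)
Record surface_of_revolution (m : R -> R) : Prop := {
  profile_smooth : forall (n : nat) (r : R), ex_derive_n m n r;
  profile_odd : forall r : R, m (- r) = - m r;
  profile_0 : m 0 = 0;
  profile_derive_0 : Derive m 0 = 1;
  profile_pos : forall r : R, 0 < r -> 0 < m r
}.

Definition metric (m : R -> R) (x : point) (u v : tangent) : R :=
  fst u * fst v + (m (fst x)) ^ 2 * (snd u * snd v).

Definition norm_h (m : R -> R) (x : point) (v : tangent) : R :=
  sqrt (metric m x v v).

(* Riemannian area form, for the orientation (d/dr, d/dtheta). *)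
Definition area_form (m : R -> R) (x : point) (u v : tangent) : R :=
  m (fst x) * (fst u * snd v - snd u * fst v).

Definition rotation_field (mu : R) : tangent := (0, mu).

Record rotational_randers (m : R -> R) (mu : R) : Prop := {
  randers_surface : surface_of_revolution m;
  randers_mu_pos : 0 < mu;
  randers_bound : forall r : R, 0 <= r -> m r < 1 / mu
}.

Definition randers_metric (m : R -> R) (mu : R) (x : point) (y : tangent) : R :=
  let W := rotation_field mu in
  let lambda := 1 - mu ^ 2 * (m (fst x)) ^ 2 in
  sqrt (lambda * metric m x y y + (metric m x W y) ^ 2) / lambda
  - metric m x W y / lambda.

Definition velocity (c : R -> point) (s : R) : tangent :=
  (Derive (fun t => fst (c t)) s, Derive (fun t => snd (c t)) s).

Definition acceleration (c : R -> point) (s : R) : tangent :=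
  (Derive_n (fun t => fst (c t)) 2 s, Derive_n (fun t => snd (c t)) 2 s).

Inductive coord := radial | angular.

Definition component (i : coord) (v : R * R) : R :=
  match i with radial => fst v | angular => snd v end.

Definition basis (i : coord) : tangent :=
  match i with radial => (1, 0) | angular => (0, 1) end.

Definition partial (i : coord) (f : point -> R) (x : point) : R :=
  match i with
  | radial => Derive (fun t => f (t, snd x)) (fst x)
  | angular => Derive (fun t => f (fst x, t)) (snd x)
  end.

Definition sum_coord (f : coord -> R) : R := f radial + f angular.

Definition metric_coef (m : R -> R) (i j : coord) (x : point) : R :=
  metric m x (basis i) (basis j).

(* Christoffel symbols of the first kind, Gamma_{k,ij}. *)
Definition christoffel (m : R -> R) (k i j : coord) (x : point) : R :=
  (partial i (metric_coef m j k) x + partial j (metric_coef m i k) x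
   - partial k (metric_coef m i j) x) / 2.

(* k-th covariant component of the covariant acceleration along c:
   h_{ki} c''^i + Gamma_{k,ij} c'^i c'^j. *)
Definition covariant_acceleration (m : R -> R) (c : R -> point) (k : coord)
    (s : R) : R :=
  sum_coord (fun i => metric_coef m k i (c s) * component i (acceleration c s))
  + sum_coord (fun i => sum_coord (fun j =>
      christoffel m k i j (c s)
      * component i (velocity c s) * component j (velocity c s))).

Definition in_interval (a b : Rbar) (s : R) : Prop :=
  Rbar_lt a s /\ Rbar_lt s b.

(* The condition 0 < r keeps the curve off the vertex, where polar coordinates
   and angles with profile curves are undefined; a geodesic through the vertex
   is covered piecewise, on the intervals where it avoids it. *)
Record unit_speed_geodesic (m : R -> R) (a b : Rbar) (c : R -> point) : Prop := {
  geodesic_off_vertex : forall s, in_interval a b s -> 0 < fst (c s);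
  geodesic_smooth : forall s, in_interval a b s ->
    forall (n : nat) (i : coord), ex_derive_n (fun t => component i (c t)) n s;
  geodesic_unit_speed : forall s, in_interval a b s ->
    norm_h m (c s) (velocity c s) = 1;
  geodesic_equation : forall s, in_interval a b s ->
    forall k : coord, covariant_acceleration m c k s = 0
}.

Definition clairaut_constant (m : R -> R) (a b : Rbar) (c : R -> point)
    (nu : R) : Prop :=
  forall s, in_interval a b s ->
    (m (fst (c s))) ^ 2 * Derive (fun t => snd (c t)) s = nu.

Definition corresponding_F_geodesic (mu : R) (c : R -> point) : R -> point :=
  fun s => (fst (c s), snd (c s) + mu * s).

(* a is a determination of the oriented h-angle from u to v (defined modulo
   2 PI, hence a relation). *)
Definition oriented_angle (m : R -> R) (x : point) (u v : tangent) (a : R) :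
    Prop :=
  metric m x u v = norm_h m x u * norm_h m x v * cos a /\
  area_form m x u v = norm_h m x u * norm_h m x v * sin a.

Definition profile_curve (theta : R) : R -> point := fun r => (r, theta).

Definition angle_with_profile_curve (m : R -> R) (c : R -> point) (s : R)
    (a : R) : Prop :=
  oriented_angle m (c s)
    (velocity (profile_curve (snd (c s))) (fst (c s))) (velocity c s) a.

Lemma velocity_corresponding (m : R -> R) (mu : R) (a b : Rbar)
    (c : R -> point) (s : R) :
  unit_speed_geodesic m a b c -> in_interval a b s ->
  velocity (corresponding_F_geodesic mu c) s
  = (fst (velocity c s), snd (velocity c s) + mu).
Proof.
intros Hc Hs; unfold velocity, corresponding_F_geodesic; simpl.
f_equal; rewrite Derive_plus.
- rewrite Derive_scal, Derive_id; ring.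
- exact (geodesic_smooth _ _ _ _ Hc s Hs 1%nat angular).
- auto_derive; exact I.
Qed.

Lemma corresponding_F_unit_speed (m : R -> R) (mu : R) (a b : Rbar)
    (c : R -> point) (s : R) :
  rotational_randers m mu -> unit_speed_geodesic m a b c -> in_interval a b s ->
  randers_metric m mu (corresponding_F_geodesic mu c s)
    (velocity (corresponding_F_geodesic mu c) s) = 1.
Proof.
intros [[_ _ _ _ Hpos] Hmu Hb] Hc Hs.
rewrite (velocity_corresponding _ _ _ _ _ _ Hc Hs).
pose proof (geodesic_off_vertex _ _ _ _ Hc s Hs) as Hr.
pose proof (geodesic_unit_speed _ _ _ _ Hc s Hs) as Hu.
pose proof (Hpos _ Hr) as Hm.
pose proof (Hb _ (Rlt_le _ _ Hr)) as Hlt.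
unfold randers_metric, norm_h, metric, rotation_field in *; simpl fst in *;
  simpl snd in *.
set (M := m (fst (c s))) in *.
set (u := Derive (fun t => fst (c t)) s) in *.
set (v := Derive (fun t => snd (c t)) s) in *.
assert (HmM : mu * M < 1).
{ apply (Rmult_lt_compat_l mu) in Hlt; [|exact Hmu].
  replace (mu * (1 / mu)) with 1 in Hlt by (field; lra). exact Hlt. }
assert (HmM0 : 0 < mu * M) by nra.
assert (Hu2 : u * u + M ^ 2 * (v * v) = 1).
{ rewrite <- (sqrt_sqrt (u * u + M ^ 2 * (v * v))); [rewrite Hu; ring | nra]. }
assert (Hv : -1 <= M * v) by nra.
assert (Hc1 : 0 <= 1 + mu * M * (M * v)) by nra.
replace ((1 - mu ^ 2 * M ^ 2) * (u * u + M ^ 2 * ((v + mu) * (v + mu)))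
  + (0 * u + M ^ 2 * (mu * (v + mu))) ^ 2)
  with (Rsqr (1 + mu * M * (M * v))).
2:{ unfold Rsqr. replace (u * u) with (1 - M ^ 2 * (v * v)) by lra. ring. }
rewrite sqrt_Rsqr by exact Hc1.
field. nra.
Qed.

(* Main.v *)
Require Import Defs.
From Stdlib Require Import Reals Lra.
From Coquelicot Require Import Coquelicot.
Open Scope R_scope.


(** In the [h]-orthonormal frame [(d/dr, (1/m) d/dtheta)] the velocity of
    [gamma] is the unit vector [(cos phi, sin phi)], and by Clairaut's relation
    [nu = m sin phi].  The flow of the rotation field only adds [mu d/dtheta],
    which is [(0, mu m)] in this frame, so the velocity of the [F]-geodesic is
    [(cos phi, sin phi + mu m)].  Let [N] be its [h]-length; then it is also
    [(N cos psi, N sin psi)], and three readings of this one vector give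
    everything:
    - its squared length is
      [N^2 = 1 + 2 mu m sin phi + (mu m)^2 = 1 + 2 mu nu + mu^2 m^2]
      ([norm_corresponding_velocity]);
    - its inner product with the velocity of [gamma] is
      [N cos (psi - phi) = 1 + mu m sin phi = 1 + mu nu];
    - [m] times its angular component is
      [m N sin psi = m (sin phi + mu m) = nu + mu m^2].
    Dividing the last identity by [N] requires [N > 0].  This is where the
    bound [m < 1/mu] enters: the rotation field has [h]-length [mu m < 1], so it
    cannot cancel a unit vector ([corresponding_velocity_neq_0]). *)

(** The profile curve has velocity [d/dr], the first vector of the orthonormal
    frame, so the angle with it is the polar angle in that frame. *)
Lemma frame_components_of_angle (m : R -> R) (c : R -> point) (s alpha : R) :
  angle_with_profile_curve m c s alpha ->
  fst (velocity c s) = norm_h m (c s) (velocity c s) * cos alpha /\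
  m (fst (c s)) * snd (velocity c s)
    = norm_h m (c s) (velocity c s) * sin alpha.
Proof.
  assert (Hprofile : velocity (profile_curve (snd (c s))) (fst (c s)) = (1, 0)).
  { unfold velocity, profile_curve; simpl.
    now rewrite Derive_id, Derive_const. }
  assert (Hunit : norm_h m (c s) (1, 0) = 1).
  { unfold norm_h, metric; simpl fst; simpl snd.
    replace (1 * 1 + m (fst (c s)) ^ 2 * (0 * 0)) with 1 by ring.
    exact sqrt_1. }
  unfold angle_with_profile_curve, oriented_angle.
  rewrite Hprofile, Hunit; intros [Hcos Hsin].
  unfold metric in Hcos; unfold area_form in Hsin.
  destruct (velocity c s) as [u v]; cbn [fst snd] in *.
  split; lra.
Qed.

Lemma unit_speed_squared (m : R -> R) (a b : Rbar) (c : R -> point) (s : R) :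
  unit_speed_geodesic m a b c -> in_interval a b s ->
  metric m (c s) (velocity c s) (velocity c s) = 1.
Proof.
  intros Hc Hs.
  rewrite <- (sqrt_sqrt (metric _ _ _ _)).
  - fold (norm_h m (c s) (velocity c s)).
    rewrite (geodesic_unit_speed _ _ _ _ Hc s Hs); ring.
  - unfold metric.
    pose proof (Rle_0_sqr (fst (velocity c s))) as Hradial.
    pose proof (Rle_0_sqr (m (fst (c s)) * snd (velocity c s))) as Hangular.
    unfold Rsqr in Hradial, Hangular; lra.
Qed.

Lemma norm_corresponding_velocity (m : R -> R) (mu : R) (a b : Rbar)
    (c : R -> point) (nu s : R) :
  unit_speed_geodesic m a b c -> clairaut_constant m a b c nu ->
  in_interval a b s ->
  norm_h m (corresponding_F_geodesic mu c s)
    (velocity (corresponding_F_geodesic mu c) s)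
  = sqrt (1 + 2 * mu * nu + mu ^ 2 * m (fst (c s)) ^ 2).
Proof.
  intros Hc Hnu Hs.
  pose proof (unit_speed_squared _ _ _ _ _ Hc Hs) as Hunit.
  rewrite (velocity_corresponding _ _ _ _ _ _ Hc Hs).
  rewrite <- (Hnu s Hs), <- Hunit.
  unfold norm_h, metric, velocity; simpl.
  f_equal; ring.
Qed.

(** If the vector vanished, the unit vector [velocity c s] would be the opposite
    of the rotation field, whose [h]-length is [mu m < 1]. *)
Lemma corresponding_velocity_neq_0 (m : R -> R) (mu : R) (a b : Rbar)
    (c : R -> point) (s : R) :
  rotational_randers m mu -> unit_speed_geodesic m a b c ->
  in_interval a b s ->
  velocity (corresponding_F_geodesic mu c) s <> (0, 0).
Proof.
  intros [[_ _ _ _ Hpos] Hmu Hbound] Hc Hs.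
  pose proof (geodesic_off_vertex _ _ _ _ Hc s Hs) as Hr.
  pose proof (Hpos _ Hr) as Hm.
  pose proof (Hbound _ (Rlt_le _ _ Hr)) as Hlt.
  pose proof (unit_speed_squared _ _ _ _ _ Hc Hs) as Hunit.
  rewrite (velocity_corresponding _ _ _ _ _ _ Hc Hs).
  intros [= Hradial Hangular].
  unfold metric, velocity in Hunit; simpl fst in Hunit; simpl snd in Hunit.
  rewrite Hradial in Hunit.
  replace (Derive (fun t => snd (c t)) s) with (- mu) in Hunit by lra.
  apply (Rmult_lt_compat_l mu) in Hlt; [|exact Hmu].
  replace (mu * (1 / mu)) with 1 in Hlt by (field; lra).
  assert (0 < mu * m (fst (c s))) by now apply Rmult_lt_0_compat.
  nra.
Qed.

Theorem theorem1p3 (m : R -> R) (mu : R) (HF : rotational_randers m mu)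
    (a b : Rbar) (gamma : R -> point) (nu : R) (phi psi : R -> R)
    (Hgamma : unit_speed_geodesic m a b gamma)
    (Hnu : clairaut_constant m a b gamma nu)
    (Hphi : forall s : R, in_interval a b s ->
       angle_with_profile_curve m gamma s (phi s))
    (Hpsi : forall s : R, in_interval a b s ->
       angle_with_profile_curve m (corresponding_F_geodesic mu gamma) s (psi s)) :
  forall s : R, in_interval a b s ->
    sqrt (1 + 2 * mu * nu + mu ^ 2 * (m (fst (gamma s))) ^ 2)
      * cos (psi s - phi s) = 1 + mu * nu
    /\
    m (fst (gamma s)) * sin (psi s)
      = (nu + mu * (m (fst (gamma s))) ^ 2)
        / sqrt (1 + 2 * mu * nu + mu ^ 2 * (m (fst (gamma s))) ^ 2).
Proof.
  intros s Hs.
  pose proof (norm_corresponding_velocity _ mu _ _ _ _ _ Hgamma Hnu Hs) as HN.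
  pose proof (corresponding_velocity_neq_0 _ _ _ _ _ _ HF Hgamma Hs) as Hneq.
  pose proof (unit_speed_squared _ _ _ _ _ Hgamma Hs) as Hunit.
  destruct (frame_components_of_angle _ _ _ _ (Hphi s Hs)) as [Hcphi Hsphi].
  destruct (frame_components_of_angle _ _ _ _ (Hpsi s Hs)) as [Hcpsi Hspsi].
  rewrite (geodesic_unit_speed _ _ _ _ Hgamma s Hs) in Hcphi, Hsphi.
  rewrite HN in Hcpsi, Hspsi.
  pose proof (randers_surface _ _ HF) as Hsurface.
  pose proof (profile_pos _ Hsurface _ (geodesic_off_vertex _ _ _ _ Hgamma s Hs))
    as Hm.
  specialize (Hnu s Hs).
  change (m (fst (gamma s)) ^ 2 * snd (velocity gamma s) = nu) in Hnu.
  rewrite (velocity_corresponding _ _ _ _ _ _ Hgamma Hs) in Hcpsi, Hspsi, Hneq.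
  unfold metric in Hunit.
  cbn [fst snd corresponding_F_geodesic] in Hcpsi, Hspsi.
  set (N := sqrt _) in *.
  set (M := m (fst (gamma s))) in *.
  set (u := fst (velocity gamma s)) in *.
  set (v := snd (velocity gamma s)) in *.
  assert (HN0 : N <> 0).
  { intros H0; apply Hneq; rewrite H0 in Hcpsi, Hspsi.
    f_equal; [lra|].
    apply (Rmult_eq_reg_l M); lra. }
  split.
  - rewrite cos_minus.
    (* The inner product of the two velocities; each factor [1] is the length
       of the velocity of [gamma]. *)
    replace (N * (cos (psi s) * cos (phi s) + sin (psi s) * sin (phi s)))
      with ((N * cos (psi s)) * (1 * cos (phi s))
            + (N * sin (psi s)) * (1 * sin (phi s))) by ring.
    rewrite <- Hcpsi, <- Hspsi, <- Hcphi, <- Hsphi, <- Hnu, <- Hunit.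
    ring.
  - apply (Rmult_eq_reg_l N); [|exact HN0].
    replace (N * (M * sin (psi s))) with (M * (N * sin (psi s))) by ring.
    rewrite <- Hspsi, <- Hnu.
    field; exact HN0.
Qed.
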